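(* Let $M$ be a stationary first-order mean-field game (MFG) model on a finite undirected network $\Gamma$ and let $W$ be the corresponding Wardrop model on the directed network $\bar\Gamma$. Suppose that a pair $(\boldsymbol u,\boldsymbol\jmath^* )$ solves $M$. Then the corresponding current distribution $\bar{\boldsymbol\jmath}^*$ on $\bar\Gamma$ is a Wardrop equilibrium for $W$; that is, $\bar{\boldsymbol\jmath}^*\in\mathcal A$ and $\langle \bar{\boldsymbol c}(\bar{\boldsymbol\jmath}^* ),\bar{\boldsymbol\jmath}^*-\bar{\boldsymbol\jmath}\rangle\le 0$ for all $\bar{\boldsymbol\jmath}\in\mathcal A$.
   Context: **MFG model $M$.** $\Gamma=(E,V)$ is a finite undirected network; an edge $e_k$ with endpoints $v_r,v_i$ is written $e_k=(v_r,v_i)$. Some vertices are entrance vertices and some others (disjoint from these) are exit vertices; all of them have incidence $1$. A current $\iota>0$ is prescribed at each entrance vertex; the exit cost is zero at each exit vertex. Each edge $e_k=(v_r,v_i)$ is identified with $[0,1]$ ($v_r$ with $0$, $v_i$ with $1$) and carries a Hamiltonian $H_k(x,p,m)$, smooth and convex in $p$, with Lagrangian $L_k(x,v,m)=\sup_p\{-pv-H_k(x,p,m)\}$. For $j\in\mathbb R$, $m^k(x,j)$ denotes the density determined by the edge MFG system $H_k(x,u_x,m)=0$, $-mD_pH_k(x,u_x,m)=j$. The travel costs are $c_k^i(j)=\min\int_0^T L_k(x,\dot x,m^k(x,j))\,dt$ over all $T$ and Lipschitz trajectories with $x(0)=0$, $x(T)=1$ (moving from $v_r$ to $v_i$), and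 $c_k^r(j)$, the same with $x(0)=1$, $x(T)=0$ (moving from $v_i$ to $v_r$). Moving from $e_k$ to $e_l$ through a common vertex $v_i$ costs a constant (switching cost) $\psi_{kl}^i$, with $\psi^i_{kl}\le\psi^i_{kp}+\psi^i_{pl}$ at vertices with more than two incident edges. (If auxiliary edges have been attached to the network to obtain entrance and exit vertices of incidence $1$ and zero exit cost, then: on an auxiliary entrance edge the travel cost into the network is $0$ and in the opposite direction $+\infty$; on an auxiliary exit edge the travel cost towards the exit is the original exit cost and in the opposite direction $+\infty$; switching from an entrance edge to an original edge costs $0$ and the reverse $+\infty$; switching from an original edge to an exit edge costs $0$ and the reverse $+\infty$.) Unknowns of $M$: for each edge $e_k=(v_r,v_i)$, currents $j_k^i,j_k^r\ge0$ (towards $v_i$, respectively $v_r$), with $j_k=j_k^i-j_k^r$; transition currents $j_{kl}^i\ge 0$ from $e_k$ to $e_l$ ($k\ne l$) through a common vertex $v_i$; and the values $u_k^i$ of the value function for each pair (edge $e_k$, endpoint $v_i$ of $e_k$), which are the boundary data of the Hamilton-Jacobi equation on $e_k$. A solution $(\boldsymbol u,\boldsymbol\jmath)$ satisfies: (1) $j_k^ij_k^r=0$ and $j_{kl}^ij_{lk}^i=0$; (2) $u_k^i\le u_l^i+\psi_{kl}^i$ and $j_{kl}^i\,(u_k^i-u_l^i-\psi_{kl}^i)=0$ for all $i,k,l$; (3) on each edge $e_k=(v_r,v_i)$: $u_k^r\le c_k^i(j_k)+u_k^i$, $u_k^i\le c_k^r(j_k)+u_k^r$, $j_k^i(u_k^r-u_k^i-c_k^i(j_k))=0$,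 $j_k^r(u_k^i-u_k^r-c_k^r(j_k))=0$; (4) for every edge $e_k=(v_r,v_i)$ and endpoint $v_i$ that is neither an entrance nor an exit, with $\mathcal E$ the set of edges other than $e_k$ incident at $v_i$: $\sum_{e_l\in\mathcal E}j_{kl}^i=j_k^i$ and $\sum_{e_l\in\mathcal E}j_{lk}^i=j_k^r$; (5) if $e_k=(v_r,v_i)$ with $v_r$ an entrance vertex with entry current $\iota$: $j_k^i=\iota$, $j_k^r=0$; (6) if $e_l=(v_i,v_s)$ with $v_s$ an exit vertex: $j_l^i=0$, and $u_l^s\le0$ with equality if $j_l^s>0$. **Corresponding Wardrop model $W$.** The vertices of the directed network $\bar\Gamma$ are the pairs $(e_k,v_i)$ with $v_i$ an endpoint of $e_k$. For each edge $e_k=(v_r,v_i)$ there are directed edges $\bar e_k^i$ from $(e_k,v_r)$ to $(e_k,v_i)$ and $\bar e_k^r$ from $(e_k,v_i)$ to $(e_k,v_r)$; for distinct edges $e_k,e_l$ with a common vertex $v_i$ there is a transition edge $\bar e_{kl}^i$ from $(e_k,v_i)$ to $(e_l,v_i)$. The directed edges pointing into an entrance vertex or out of an exit vertex are deleted. The MFG currents $j_k^i$, $j_{kl}^i$ correspond to the currents on $\bar e_k^i$, $\bar e_{kl}^i$. The cost on $\bar e_k^i$ is $c_k^i(j_k^i-j_k^r)$, on $\bar e_k^r$ it is $c_k^r(j_k^r-j_k^i)$, and on $\bar e_{kl}^i$ it is $\psi_{kl}^i$; $\bar{\boldsymbol c}(\bar{\boldsymbol\jmath})$ is the vector of these costs.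 $\mathcal A$ (admissible distributions) is the set of $\bar{\boldsymbol\jmath}\ge0$ satisfying Kirchhoff's law $K\bar{\boldsymbol\jmath}=B$: at every non-exit vertex of $\bar\Gamma$, (sum of outgoing currents) $-$ (sum of incoming currents) equals the prescribed entry current at entrance vertices and $0$ at the others. $\langle\cdot,\cdot\rangle$ is the Euclidean inner product.
   Formalization: The cost on the reversed edge is taken as c_k^r(j_k^i − j_k^r), the same argument j_k as in condition (3), instead of the printed c_k^r(j_k^r − j_k^i), for which the claim fails when the density is not even in the current. *)

(* Defs.v *)
From HB Require Import structures.
From mathcomp Require Import all_boot all_order all_algebra.
From mathcomp Require Import all_classical all_reals all_analysis.

Set Implicit Arguments.
Unset Strict Implicit.
Unset Printing Implicit Defensive.

Import Order.TTheory GRing.Theory Num.Theory.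
Import numFieldNormedType.Exports.

Local Open Scope classical_set_scope.
Local Open Scope ring_scope.

(** * Finite networks *)

(* Each edge is identified with [0, 1], its [edge_tail] with 0 and its
   [edge_head] with 1. This only fixes a coordinate: agents may travel in both
   directions. Parallel edges are allowed, loops are not. *)
Record network := Network {
  vert : finType;
  edge : finType;
  edge_tail : edge -> vert;
  edge_head : edge -> vert;
  edge_tail_head : forall e, edge_tail e != edge_head e
}.

Definition incident (G : network) (e : edge G) (v : vert G) : bool :=
  (v == edge_tail e) || (v == edge_head e).

(* The endpoint of [e] other than [v], when [v] is an endpoint of [e]. *)
Definition opp_end (G : network) (e : edge G) (v : vert G) : vert G :=
  if v == edge_head e then edge_tail e else edge_head e.

Definition common_vertex (G : network) (k l : edge G) (v : vert G) : bool :=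
  [&& k != l, incident k v & incident l v].

(** * Hamiltonians and the mean-field system on one edge *)

Definition lagrangian (R : realType) (H : R -> R -> R -> R) (x v m : R)
    : \bar R :=
  ereal_sup [set (- p * v - H x p m)%:E | p in [set: R]].

(* Regularity is only required at positive densities, so that Hamiltonians that
   are singular at zero density (congestion) are not excluded. *)
Definition smooth_convex_in_p (R : realType) (H : R -> R -> R -> R) : Prop :=
  forall x m : R, 0 <= x <= 1 -> 0 < m ->
    (forall (n : nat) (p : R), derivable (derive1n n (fun q => H x q m)) p 1) /\
    convex_function [set: R^o] (fun q : R^o => H x q m : R^o).

(* [u] is the value function on the edge, [m] the density and [j] the current,
   counted positively from 0 to 1. Derivability of [u] at 0 and 1 amounts to
   one-sided derivability, as [u] may be chosen freely outside [0, 1]. *)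
Definition edge_system (R : realType) (H : R -> R -> R -> R) (j : R)
    (u m : R -> R) : Prop :=
  forall x : R, 0 <= x <= 1 ->
    [/\ 0 <= m x,
        derivable u x 1,
        H x (derive1 u x) (m x) = 0 &
        - m x * derive1 (fun p => H x p (m x)) (derive1 u x) = j].

(* Here [dens x j] is the density at [x] when the current is [j]. *)
Definition determined_density (R : realType) (H : R -> R -> R -> R)
    (dens : R -> R -> R) : Prop :=
  forall j : R,
    (exists u, edge_system H j u (fun x => dens x j)) /\
    (forall u m, edge_system H j u m ->
       forall x : R, 0 <= x <= 1 -> m x = dens x j).

(* The infimum is the minimum whenever the latter exists. It need not exist for
   all currents: for H = p^2/2 - m and j = 0, the trajectory of constant speed
   1/T costs 1/(2T), and the infimum 0 is not attained. *)
Definition trajectory_cost (R : realType) (H : R -> R -> R -> R)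
    (dens : R -> R -> R) (x0 x1 j : R) : \bar R :=
  ereal_inf [set c | exists (T : R) (x : R -> R),
    [/\ 0 < T,
        [lipschitz x t | t in `[0, T]],
        forall t, t \in `[0, T]%R -> 0 <= x t <= 1,
        x 0 = x0 /\ x T = x1 &
        c = (\int[@lebesgue_measure R]_(t in `[0%R, T])
               lagrangian H (x t) (derive1 x t) (dens (x t) j))%E]].

(** * The mean-field game on a network *)

Record mfg (R : realType) := MFG {
  net :> network;
  entrances : {set vert net};
  exits : {set vert net};
  entrances_exits_disjoint : forall v, v \in entrances -> v \notin exits;
  incidence1 : forall v, v \in entrances :|: exits ->
    #|[pred e : edge net | incident e v]| = 1%N;
  entry_current : vert net -> R;
  entry_current_gt0 : forall v, v \in entrances -> 0 < entry_current v;
  (* The auxiliary edges attached to an initial network; there may be none, and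
     an edge at an entrance or exit vertex need not be auxiliary. *)
  aux_entrance : {set edge net};
  aux_exit : {set edge net};
  aux_disjoint : forall e, e \in aux_entrance -> e \notin aux_exit;
  aux_entranceP : forall e, e \in aux_entrance ->
    exists2 v, v \in entrances & incident e v;
  aux_exitP : forall e, e \in aux_exit ->
    exists2 v, v \in exits & incident e v;
  original_edges := ~: (aux_entrance :|: aux_exit);
  (* The exit cost of the initial network, moved to the auxiliary exit edge. *)
  exit_cost : edge net -> R;
  hamiltonian : edge net -> R -> R -> R -> R;
  hamiltonianP : forall e, e \in original_edges ->
    smooth_convex_in_p (hamiltonian e);
  edge_density : edge net -> R -> R -> R;
  edge_densityP : forall e, e \in original_edges ->
    determined_density (hamiltonian e) (edge_density e);
  (* [switch_cost k l v] is the cost of moving from [k] to [l] through [v]. *)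
  switch_cost : edge net -> edge net -> vert net -> \bar R;
  switch_cost_original : forall k l v, common_vertex k l v ->
    k \in original_edges -> l \in original_edges ->
    switch_cost k l v \is a fin_num;
  switch_cost_entrance : forall k l v, common_vertex k l v ->
    k \in aux_entrance -> l \in original_edges ->
    switch_cost k l v = 0%E /\ switch_cost l k v = +oo%E;
  switch_cost_exit : forall k l v, common_vertex k l v ->
    k \in original_edges -> l \in aux_exit ->
    switch_cost k l v = 0%E /\ switch_cost l k v = +oo%E;
  switch_cost_gtNy : forall k l v, common_vertex k l v ->
    switch_cost k l v != -oo%E;
  switch_cost_triangle : forall k p l v,
    common_vertex k p v -> common_vertex p l v -> common_vertex k l v ->
    (switch_cost k l v <= switch_cost k p v + switch_cost p l v)%E
}.

(* [travel_cost e v j] is the cost of crossing [e] towards its endpoint [v]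
   when the net current on [e] is [j]. Whatever the direction of travel, [j] is
   counted from [edge_tail e] to [edge_head e], as in [edge_system]. *)
Definition travel_cost (R : realType) (M : mfg R) (e : edge M) (v : vert M)
    (j : R) : \bar R :=
  if e \in aux_entrance M then
    (if v \in entrances M then +oo else 0)%E
  else if e \in aux_exit M then
    (if v \in exits M then (exit_cost e)%:E else +oo)%E
  else if v == edge_head e then
    trajectory_cost (hamiltonian e) (edge_density e) 0 1 j
  else
    trajectory_cost (hamiltonian e) (edge_density e) 1 0 j.

(* [ecur e v] is the current on [e] towards its endpoint [v], and [tcur k l v]
   the transition current from [k] to [l] through [v]. Values at non-incident
   arguments are meaningless and never used. *)
Record currents (R : realType) (G : network) := Currents {
  ecur : edge G -> vert G -> R;
  tcur : edge G -> edge G -> vert G -> R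
}.

Definition net_current (R : realType) (G : network) (j : currents R G)
    (e : edge G) : R :=
  ecur j e (edge_head e) - ecur j e (edge_tail e).

(* Costs may be +oo; the products below use the convention 0 * (+oo) = 0 of
   [\bar R], so that they vanish only if an infinitely costly move carries no
   current. *)
Record mfg_solution (R : realType) (M : mfg R)
    (u : edge M -> vert M -> R) (j : currents R M) : Prop := MFGSolution {
  ecur_ge0 : forall e v, incident e v -> 0 <= ecur j e v;
  tcur_ge0 : forall k l v, common_vertex k l v -> 0 <= tcur j k l v;
  ecur_oneway : forall e, ecur j e (edge_head e) * ecur j e (edge_tail e) = 0;
  tcur_oneway : forall k l v, common_vertex k l v ->
    tcur j k l v * tcur j l k v = 0;
  switch_optimal : forall k l v, common_vertex k l v ->
    ((u k v)%:E <= (u l v)%:E + switch_cost k l v)%E /\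
    ((tcur j k l v)%:E * ((u k v)%:E - (u l v)%:E - switch_cost k l v) = 0)%E;
  travel_optimal : forall e v, incident e v ->
    ((u e (opp_end e v))%:E
       <= travel_cost e v (net_current j e) + (u e v)%:E)%E /\
    ((ecur j e v)%:E *
       ((u e (opp_end e v))%:E - (u e v)%:E
          - travel_cost e v (net_current j e)) = 0)%E;
  balance : forall e v, incident e v ->
    v \notin entrances M -> v \notin exits M ->
    \sum_(l | common_vertex e l v) tcur j e l v = ecur j e v /\
    \sum_(l | common_vertex e l v) tcur j l e v = ecur j e (opp_end e v);
  entrance_condition : forall e v, incident e v -> v \in entrances M ->
    ecur j e (opp_end e v) = entry_current v /\ ecur j e v = 0;
  exit_condition : forall e v, incident e v -> v \in exits M ->
    [/\ ecur j e (opp_end e v) = 0,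
        u e v <= 0 &
        0 < ecur j e v -> u e v = 0]
}.

(** * Wardrop models *)

(* Arc costs may depend on the whole current distribution. *)
Record wardrop (R : realType) := Wardrop {
  wvert : finType;
  warc : finType;
  wsrc : warc -> wvert;
  wtgt : warc -> wvert;
  wexits : {pred wvert};
  wentry : wvert -> R;
  wcost : (warc -> R) -> warc -> \bar R
}.
Arguments wexits {R} w _.

Definition admissible (R : realType) (W : wardrop R) (j : warc W -> R) : Prop :=
  (forall a, 0 <= j a) /\
  (forall p : wvert W, p \notin wexits W ->
     \sum_(a | wsrc a == p) j a - \sum_(a | wtgt a == p) j a = wentry p).

Definition wardrop_equilibrium (R : realType) (W : wardrop R)
    (j : warc W -> R) : Prop :=
  admissible j /\
  forall j' : warc W -> R, admissible j' ->
    (\sum_a wcost j a * (j a - j' a)%:E <= 0)%E.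

(** * The Wardrop model of a mean-field game *)

Definition wnode (G : network) : finType :=
  {p : edge G * vert G | incident p.1 p.2}.

(* [inl (e, v)] is the arc along [e] towards its endpoint [v], and
   [inr (k, l, v)] the transition arc from (k, v) to (l, v). *)
Definition raw_arc (G : network) : finType :=
  ((edge G * vert G) + (edge G * edge G * vert G))%type.

Definition raw_src (G : network) (a : raw_arc G) : edge G * vert G :=
  match a with
  | inl (e, v) => (e, opp_end e v)
  | inr (k, l, v) => (k, v)
  end.

Definition raw_tgt (G : network) (a : raw_arc G) : edge G * vert G :=
  match a with
  | inl (e, v) => (e, v)
  | inr (k, l, v) => (l, v)
  end.

Definition raw_wf (G : network) (a : raw_arc G) : bool :=
  match a with
  | inl (e, v) => incident e v
  | inr (k, l, v) => common_vertex k l v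
  end.

Definition is_arc (R : realType) (M : mfg R) (a : raw_arc M) : bool :=
  [&& raw_wf a, (raw_tgt a).2 \notin entrances M
              & (raw_src a).2 \notin exits M].

Definition mfg_arc (R : realType) (M : mfg R) : finType :=
  {a : raw_arc M | is_arc a}.

Lemma raw_src_incident (G : network) (a : raw_arc G) :
  raw_wf a -> incident (raw_src a).1 (raw_src a).2.
Proof.
case: a => [[e v]|[[k l] v]] /=; last by case/and3P.
by move=> _; rewrite /opp_end /incident; case: ifP; rewrite eqxx ?orbT.
Qed.

Lemma raw_tgt_incident (G : network) (a : raw_arc G) :
  raw_wf a -> incident (raw_tgt a).1 (raw_tgt a).2.
Proof. by case: a => [[e v]|[[k l] v]] //=; case/and3P. Qed.

Lemma arc_wf (R : realType) (M : mfg R) (a : mfg_arc M) : raw_wf (val a).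
Proof. by case/and3P: (valP a). Qed.

Definition arc_src (R : realType) (M : mfg R) (a : mfg_arc M) : wnode M :=
  exist _ (raw_src (val a)) (raw_src_incident (arc_wf a)).

Definition arc_tgt (R : realType) (M : mfg R) (a : mfg_arc M) : wnode M :=
  exist _ (raw_tgt (val a)) (raw_tgt_incident (arc_wf a)).

(* Deleted arcs carry no current. *)
Definition arc_current (R : realType) (M : mfg R) (j : mfg_arc M -> R)
    (a : raw_arc M) : R :=
  oapp j 0 (insub a).

(* Converts a net current counted towards the endpoint [v] of [e] into one
   counted from [edge_tail e] to [edge_head e], as [travel_cost] expects. The
   cost of an arc is a function of the difference between its current and that
   of the opposite arc, which is counted in the direction of the arc; without
   the conversion, the two arcs of an edge would see opposite currents, and the
   densities at [j] and [- j] differ unless the Hamiltonian is symmetric. *)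
Definition tail_to_head (R : realType) (G : network) (e : edge G) (v : vert G)
    (j : R) : R :=
  if v == edge_head e then j else - j.

Definition arc_cost (R : realType) (M : mfg R) (j : mfg_arc M -> R)
    (a : mfg_arc M) : \bar R :=
  match val a with
  | inl (e, v) =>
      travel_cost e v (tail_to_head e v
        (arc_current j (inl (e, v)) - arc_current j (inl (e, opp_end e v))))
  | inr (k, l, v) => switch_cost k l v
  end.

Definition wardrop_of (R : realType) (M : mfg R) : wardrop R := {|
  wvert := wnode M;
  warc := mfg_arc M;
  wsrc := @arc_src R M;
  wtgt := @arc_tgt R M;
  wexits := [pred p : wnode M | (val p).2 \in exits M];
  wentry := fun p : wnode M =>
    if (val p).2 \in entrances M then entry_current (val p).2 else 0;
  wcost := @arc_cost R M
|}.

Definition wardrop_current (R : realType) (M : mfg R) (j : currents R M)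
    : warc (wardrop_of M) -> R :=
  fun a : mfg_arc M =>
    match val a with
    | inl (e, v) => ecur j e v
    | inr (k, l, v) => tcur j k l v
    end.

(* Main.v *)
Require Import Defs.
From mathcomp Require Import all_boot all_order all_algebra.
From mathcomp Require Import all_classical all_reals all_analysis.
From mathcomp Require Import lra.

(** The value function is a potential on the Wardrop network: along every arc
    its drop is at most the cost, with equality if the arc carries current.
    So, with [j] the current of the game and [j'] any competitor,
    [c * (j - j') <= (drop of u) * (j - j')] arc by arc. Summation by parts
    turns the right-hand sides into the sum over the nodes of [u] times the
    divergence of [j - j'], which vanishes except at the exits; there no current
    leaves, [u <= 0], and [u = 0] where [j] arrives. *)

Set Implicit Arguments.
Unset Strict Implicit.
Unset Printing Implicit Defensive.

Import Order.TTheory GRing.Theory Num.Theory.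
Local Open Scope ring_scope.

(** Grouping the arcs by source and by target collects, at each node, its outgoing minus its
    incoming flow. *)
Lemma sum_arc_drop (R : realType) (W : wardrop R) (f : wvert W -> R)
    (x : warc W -> R) :
  \sum_a (f (wsrc a) - f (wtgt a)) * x a =
  \sum_p f p * (\sum_(a | wsrc a == p) x a - \sum_(a | wtgt a == p) x a).
Proof.
have byend (g : warc W -> wvert W) :
    \sum_a f (g a) * x a = \sum_p f p * \sum_(a | g a == p) x a.
  rewrite (partition_big g xpredT) //=; apply: eq_bigr => p _.
  by rewrite mulr_sumr; apply: eq_bigr => a /eqP->.
under eq_bigr do rewrite mulrBl.
rewrite sumrB (byend (@wsrc R W)) (byend (@wtgt R W)) -sumrB.
by apply: eq_bigr => p _; rewrite mulrBr.
Qed.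

(** For finite [c], complementarity leaves [(s - t - c) * (x - y) = (c + t - s) * y], a product of
    nonnegative factors. *)
Lemma arc_cost_le_drop (R : realType) (s t x y : R) (c : \bar R) :
    0 <= x -> 0 <= y -> (s%:E <= c + t%:E)%E ->
    (x%:E * (s%:E - t%:E - c) = 0)%E ->
  (c * (x - y)%:E <= ((s - t) * (x - y))%:E)%E.
Proof.
move=> x0 y0; case: c => [c| |] //=.
- rewrite -!EFinD lee_fin => le_s [] xc; rewrite lee_fin.
  nra.
(* For [c = +oo] complementarity forces [x = 0]; the left side is then [-oo], or 0 when [y = 0]. *)
- move=> _ /eqP; rewrite mule_eq0 => /orP[/eqP[->]|//].
  rewrite sub0r; move: y0; rewrite le_eqVlt => /orP[/eqP<-|y0].
    by rewrite oppr0 mule0 mulr0.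
  by rewrite lt0_mulye ?leNye// lte_fin oppr_lt0.
Qed.

Lemma potential_equilibrium (R : realType) (W : wardrop R)
    (f : wvert W -> R) (j : warc W -> R) :
    admissible j ->
    (forall a, ((f (wsrc a))%:E <= wcost j a + (f (wtgt a))%:E)%E) ->
    (forall a, ((j a)%:E *
      ((f (wsrc a))%:E - (f (wtgt a))%:E - wcost j a) = 0)%E) ->
    (forall a : warc W, wsrc a \notin wexits W) ->
    (forall p, p \in wexits W -> f p <= 0) ->
    (forall a, wtgt a \in wexits W -> 0 < j a -> f (wtgt a) = 0) ->
  wardrop_equilibrium j.
Proof.
move=> jA drop_le drop_eq no_out f_le0 f_eq0; split=> // j' j'A.
have [j0 jK] := jA; have [j'0 j'K] := j'A.
apply: (@le_trans _ _
    (\sum_a ((f (wsrc a) - f (wtgt a)) * (j a - j' a))%:E)%E).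
  by apply: lee_sum => a _; exact: arc_cost_le_drop.
rewrite sumEFin lee_fin sum_arc_drop; apply: sumr_le0 => p _.
rewrite !sumrB.
have [pX|pX] := boolP (p \in wexits W); last first.
  (* Off the exits both flows have the divergence [wentry p]. *)
  have := jK p pX; have := j'K p pX; set e := wentry p => E' E.
  by rewrite [X in f p * X](_ : _ = 0) ?mulr0//; lra.
rewrite !(big_pred0 _ _ _ (P := fun a => wsrc a == p)); last 2 first.
- by move=> a; apply/negbTE; apply: contraNneq (no_out a) => ->.
- by move=> a; apply/negbTE; apply: contraNneq (no_out a) => ->.
(* With no outgoing arcs, the term at an exit is [f p] times the inflow of [j'] minus that of
   [j]. *)
have fj : f p * \sum_(a | wtgt a == p) j a = 0.
  rewrite mulr_sumr big1 // => a /eqP ap.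
  have := j0 a; rewrite le_eqVlt => /orP[/eqP<-|ja]; first by rewrite mulr0.
  by rewrite -ap f_eq0 ?mul0r// ap.
have : f p * \sum_(a | wtgt a == p) j' a <= 0.
  by apply: mulr_le0_ge0; [exact: f_le0|exact: sumr_ge0].
lra.
Qed.

Section Network.
Variable G : network.
Implicit Types (e k l : edge G) (v : vert G).

Lemma opp_endK e v : incident e v -> opp_end e (opp_end e v) = v.
Proof.
have /negbTE ne := edge_tail_head e.
by rewrite /incident /opp_end => /orP[]/eqP->; rewrite ?ne ?eqxx ?ne.
Qed.

Lemma incident_opp_end e v : incident e (opp_end e v).
Proof. by rewrite /opp_end /incident; case: ifP; rewrite eqxx ?orbT. Qed.

(** Deleted arcs are included, so that Kirchhoff sums can be computed over plain tuples instead of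
    the subtype [mfg_arc]. *)
Definition raw_current (R : realType) (j : currents R G) (a : raw_arc G) : R :=
  match a with
  | inl (e, v) => ecur j e v
  | inr (k, l, v) => tcur j k l v
  end.

Lemma sum_raw_src (R : realType) (j : currents R G) e v :
    incident e v ->
  \sum_(a | raw_wf a && (raw_src a == (e, v))) raw_current j a =
  ecur j e (opp_end e v) + \sum_(l | common_vertex e l v) tcur j e l v.
Proof.
move=> ev; rewrite big_sumType /=; congr (_ + _).
  rewrite (big_pred1 (e, opp_end e v)) // => -[e' v'] /=.
  rewrite !xpair_eqE; have [->|//] := eqVneq e' e; rewrite ?andbF //=.
  apply/andP/eqP => [[ev' /eqP<-]|->]; first by rewrite opp_endK.
  by rewrite incident_opp_end opp_endK ?eqxx.
rewrite (reindex_onto (fun l => (e, l, v)) (fun a => a.1.2)) /=; last first.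
  by move=> [[k l] w] /= /andP[_ /eqP[-> ->]].
by apply: eq_bigl => l; rewrite !eqxx !andbT.
Qed.

Lemma sum_raw_tgt (R : realType) (j : currents R G) e v :
    incident e v ->
  \sum_(a | raw_wf a && (raw_tgt a == (e, v))) raw_current j a =
  ecur j e v + \sum_(l | common_vertex e l v) tcur j l e v.
Proof.
move=> ev; rewrite big_sumType /=; congr (_ + _).
  rewrite (big_pred1 (e, v)) // => -[e' v'] /=.
  by apply/andP/eqP => [[_ /eqP]//|[-> ->]].
rewrite (reindex_onto (fun l => (l, e, v)) (fun a => a.1.1)) /=; last first.
  by move=> [[k l] w] /= /andP[_ /eqP[-> ->]].
apply: eq_bigl => l; rewrite !eqxx !andbT.
by rewrite /common_vertex eq_sym [incident l v && _]andbC.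
Qed.

End Network.

Section Game.
Variables (R : realType) (M : mfg R).

(** Incidence 1 rules out a second edge at the vertex. *)
Lemma no_switch_at_end (k l : edge M) (v : vert M) :
  v \in entrances M :|: exits M -> common_vertex k l v = false.
Proof.
move=> /incidence1/mem_card1[e0 E].
apply/negP => /and3P[kl kv lv]; move: kl.
have := E k; have := E l; rewrite !inE kv lv.
by move=> /esym/eqP-> /esym/eqP->; rewrite eqxx.
Qed.

Lemma sum_mfg_arc (P : pred (raw_arc M)) (F : raw_arc M -> R) :
    (forall a, raw_wf a -> ~~ is_arc a -> F a = 0) ->
  \sum_(a : mfg_arc M | P (val a)) F (val a) = \sum_(a | raw_wf a && P a) F a.
Proof.
move=> F0; rewrite [RHS](bigID (@is_arc R M)) /= [X in _ + X]big1 ?addr0; last first.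
  by move=> a /andP[/andP[wfa _] na]; exact: F0.
rewrite [RHS](eq_bigl (fun a => is_arc a && P a)); last first.
  by move=> a; rewrite /is_arc; case: (raw_wf a); rewrite ?andbF// andbC.
by rewrite [RHS]big_mkcondr [RHS]big_sub -big_mkcond.
Qed.

Variables (u : edge M -> vert M -> R) (j : currents R M).
Hypothesis sol : mfg_solution u j.

(** The entrance and exit conditions kill the travel currents into entrances and out of exits;
    transition arcs do not occur there. *)
Lemma deleted_arc_current0 (a : raw_arc M) :
  raw_wf a -> ~~ is_arc a -> raw_current j a = 0.
Proof.
rewrite /is_arc => wfa; rewrite wfa /= negb_and !negbK.
case: a wfa => [[e v]|[[k l] v]] /=.
  move=> ev /orP[vE|vX]; first by have [] := entrance_condition sol ev vE.
  have [] := exit_condition sol (incident_opp_end e v) vX.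
  by rewrite opp_endK.
by move=> klv vEX; rewrite (no_switch_at_end k l) ?inE in klv.
Qed.

Lemma arc_current_wardrop (a : raw_arc M) :
  raw_wf a -> arc_current (wardrop_current j) a = raw_current j a.
Proof.
rewrite /arc_current => wfa; case: insubP => [b _ <-//|na] /=.
by rewrite deleted_arc_current0.
Qed.

(** Both arcs of an edge thus get the travel costs of the game: towards the tail, the difference of
    currents and its conversion each change the sign. *)
Lemma tail_to_head_wardrop (e : edge M) (v : vert M) : incident e v ->
  tail_to_head e v
    (arc_current (wardrop_current j) (inl (e, v)) -
     arc_current (wardrop_current j) (inl (e, opp_end e v))) =
  net_current j e.
Proof.
move=> ev; rewrite !arc_current_wardrop /= ?incident_opp_end //.
rewrite /tail_to_head /net_current /opp_end; have [->//|ne] := eqVneq v _.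
move: ev; rewrite /incident (negbTE ne) orbF => /eqP->.
by rewrite opprB.
Qed.

Lemma wardrop_current_admissible : admissible (wardrop_current j).
Proof.
split=> [[a arca]|[[e v] /= ev]].
  have /and3P[wfa _ _] := arca.
  case: a arca wfa => [[e v]|[[k l] v]] /= arca; rewrite /wardrop_current /=.
    exact: ecur_ge0 sol _ _.
  exact: tcur_ge0 sol _ _ _.
rewrite inE /= => vX.
transitivity (\sum_(a | raw_wf a && (raw_src a == (e, v))) raw_current j a -
              \sum_(a | raw_wf a && (raw_tgt a == (e, v))) raw_current j a).
  by rewrite -!sum_mfg_arc //; exact: deleted_arc_current0.
rewrite sum_raw_src // sum_raw_tgt //.
(* Away from entrances, [balance] makes outflow and inflow both the sum of the two currents on [e].
   At an entrance the transition sums are empty. *)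
case: ifPn => [vE|vE]; last by have [-> ->] := balance sol ev vE vX; lra.
rewrite !big_pred0; try by move=> l; rewrite no_switch_at_end ?inE ?vE.
by have [-> ->] := entrance_condition sol ev vE; rewrite !addr0 subr0.
Qed.

End Game.

Theorem theorem5p3 (R : realType) (M : mfg R)
  (u : edge M -> vert M -> R) (j : currents R M) :
  mfg_solution u j -> wardrop_equilibrium (wardrop_current j).
Proof.
move=> sol.
apply: (@potential_equilibrium R (wardrop_of M)
         (fun p : wnode M => u (val p).1 (val p).2)).
- exact: wardrop_current_admissible sol.
- case=> -[[e v]|[[k l] v]] arca /=; have /and3P[wfa _ _] := arca.
    rewrite /arc_cost /= (tail_to_head_wardrop sol) //.
    by have [] := travel_optimal sol wfa.
  by have [+ _] := switch_optimal sol wfa; rewrite addeC.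
- case=> -[[e v]|[[k l] v]] arca /=; have /and3P[wfa _ _] := arca.
    rewrite /arc_cost /= (tail_to_head_wardrop sol) //.
    by have [] := travel_optimal sol wfa.
  by have [] := switch_optimal sol wfa.
- by case=> a arca; have /and3P[] := arca.
- by case=> [[e v] ev]; rewrite inE /= => vX; have [] := exit_condition sol ev vX.
- case=> -[[e v]|[[k l] v]] arca; rewrite inE /=; have /and3P[wfa _ /= nX] := arca.
    by move=> vX; have [_ _] := exit_condition sol wfa vX.
  (* A transition arc stays at its vertex, and no arc starts at an exit. *)
  by rewrite (negbTE nX).
Qed.
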